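(* Let $(X,G)$ be a complete $G$-metric space, let $\phi:X\to\mathbb{R}$ be a function that is bounded from above, and let $\preceq$ be the preorder on $X$ induced by $\phi$, i.e. $x\preceq y \Longleftrightarrow G(x,y,y)\le \phi(y)-\phi(x)$. Let $n\ge 2$ and let $F:X^n\to X$ be a preorder-preserving and sequentially continuous mapping such that there exist $n$ elements $x_0^1,\dots,x_0^n\in X$ with $$x_0^i\preceq F(x_0^i,x_0^{i+1},\dots,x_0^n,x_0^1,\dots,x_0^{i-1})\quad\text{for all } i,\ 1\le i\le n.$$ Then $F$ has an $n$-tuple fixed point in $X^n$.
   Context: A $G$-metric space $(X,G)$ is a nonempty set $X$ with a function $G:X\times X\times X\to[0,\infty)$ such that: (G1) $G(x,y,z)=0$ if $x=y=z$; (G2) $G(x,x,y)>0$ whenever $x\ne y$; (G3) $G(x,x,y)\le G(x,y,z)$ whenever $z\neq y$; (G4) $G$ is symmetric in all three variables; (G5) $G(x,y,z)\le G(x,a,a)+G(a,y,z)$ for all $x,y,z,a\in X$. A sequence $(x_l)$ in $X$ $G$-converges to $x\in X$ (written $x_l\to x$) if $\lim_{l,m\to\infty}G(x,x_l,x_m)=0$. It is $G$-Cauchy if $G(x_l,x_m,x_k)\to 0$ as $l,m,k\to\infty$. The space $(X,G)$ is complete if every $G$-Cauchy sequence $G$-converges to a point of $X$. A mapping $F:X^n\to X$ is preorder-preserving if $x_i\preceq z_i$ for all $i=1,\dots,n$ implies $F(x_1,\dots,x_n)\preceq F(z_1,\dots,z_n)$. It is sequentially continuous if, whenever $x_l^i\to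 x^{*,i}$ as $l\to\infty$ for each $i=1,\dots,n$, one has $F(x_l^i,x_l^{i+1},\dots,x_l^n,x_l^1,\dots,x_l^{i-1})\to F(x^{*,i},x^{*,i+1},\dots,x^{*,n},x^{*,1},\dots,x^{*,i-1})$. An element $(x^1,\dots,x^n)\in X^n$ is an $n$-tuple fixed point of $F:X^n\to X$ if $F(x^i,x^{i+1},\dots,x^n,x^1,\dots,x^{i-1})=x^i$ for all $1\le i\le n$. *)

(* Defs.v *)
From mathcomp Require Import all_boot all_order all_algebra.
From mathcomp Require Import all_classical all_reals all_analysis.

Set Implicit Arguments.
Unset Strict Implicit.
Unset Printing Implicit Defensive.

Import Order.TTheory GRing.Theory Num.Theory.
Import numFieldNormedType.Exports.

Local Open Scope classical_set_scope.
Local Open Scope ring_scope.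

Record is_Gmetric (R : realType) (X : Type) (G : X -> X -> X -> R) : Prop := {
  Gmetric_nonempty : inhabited X ;
  Gmetric_ge0 : forall x y z, 0 <= G x y z ;
  Gmetric_xxx : forall x, G x x x = 0 ;
  Gmetric_gt0 : forall x y, x <> y -> 0 < G x x y ;
  Gmetric_le : forall x y z, z <> y -> G x x y <= G x y z ;
  Gmetric_sym : forall x y z,
    [/\ G x y z = G x z y, G x y z = G y x z, G x y z = G y z x,
        G x y z = G z x y & G x y z = G z y x] ;
  Gmetric_triangle : forall x y z a, G x y z <= G x a a + G a y z
}.

Section GMetric.
Context (R : realType) (X : Type) (G : X -> X -> X -> R).

Definition Gcvg (u : nat -> X) (x : X) : Prop :=
  G x (u p.1) (u p.2) @[p --> filter_prod \oo \oo] --> (0 : R).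

Definition Gcauchy (u : nat -> X) : Prop :=
  G (u p.1) (u p.2.1) (u p.2.2)
    @[p --> filter_prod \oo (filter_prod \oo \oo)] --> (0 : R).

Definition Gcomplete : Prop :=
  forall u : nat -> X, Gcauchy u -> exists x : X, Gcvg u x.

Definition Gpreorder (phi : X -> R) (x y : X) : Prop :=
  G x y y <= phi y - phi x.

(* With indices starting at 0, [rot_tuple i x] is the cyclic shift            *)
(* (x_i, x_{i+1}, ..., x_{n-1}, x_0, ..., x_{i-1}) of x.                      *)
Definition seq_continuous (n : nat) (F : n.-tuple X -> X) : Prop :=
  forall (u : nat -> n.-tuple X) (x : n.-tuple X),
    (forall i : 'I_n, Gcvg (fun l => tnth (u l) i) (tnth x i)) ->
    forall i : 'I_n,
      Gcvg (fun l => F (rot_tuple i (u l))) (F (rot_tuple i x)).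

End GMetric.

Definition preorder_preserving (X : Type) (le : X -> X -> Prop) (n : nat)
    (F : n.-tuple X -> X) : Prop :=
  forall x z : n.-tuple X,
    (forall i : 'I_n, le (tnth x i) (tnth z i)) -> le (F x) (F z).

Definition tuple_fixpoint (X : Type) (n : nat) (F : n.-tuple X -> X)
    (x : n.-tuple X) : Prop :=
  forall i : 'I_n, F (rot_tuple i x) = tnth x i.

(* Main.v *)
Require Import Defs.
From mathcomp Require Import all_boot all_order all_algebra.
From mathcomp Require Import all_classical all_reals all_analysis.
From mathcomp Require Import lra.

(* Every component of the Picard iterates of the map whose components are the *)
(* F (rot_tuple i x), started at x0, increases for the preorder. Hence phi is *)
(* nondecreasing along it, thus convergent, and by definition of the preorder *)
(* the phi-increments control G, so the component is G-Cauchy. The limits     *)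
(* form a fixed point by continuity of F and uniqueness of G-limits.          *)

Set Implicit Arguments.
Unset Strict Implicit.
Unset Printing Implicit Defensive.

Import Order.TTheory GRing.Theory Num.Theory.
Import numFieldNormedType.Exports.

Local Open Scope classical_set_scope.
Local Open Scope ring_scope.

(** An $n$-tuple fixed point of [F] is a fixed point of the self-map [cyclic_map F] of $X^n$, which
    is monotone componentwise and sends [x0] to a tuple above it. [G x y y] acts as a distance,
    symmetric up to a factor 2 ([Gmetric_swap]), so bounded monotone [phi] values force Cauchyness
    ([Gpreorder_nondecreasing_Gcauchy]). [Gcvg_diag_unique] then identifies the two limits of each
    component. *)

(** The source index is read off the rotated tuple of indices, hence is the same for all [x], and no
    modular arithmetic arises. *)
Lemma tnth_rot_tuple (X : Type) (n : nat) (i : nat) (x : n.-tuple X)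
    (j : 'I_n) :
  tnth (rot_tuple i x) j = tnth x (tnth (rot_tuple i (ord_tuple n)) j).
Proof.
rewrite -[RHS]tnth_map; congr (tnth _ j); apply: val_inj => /=.
by rewrite map_rot map_tnth_enum.
Qed.

Section GMetricTheory.
Context (R : realType) (X : Type) (G : X -> X -> X -> R).
Hypothesis hG : is_Gmetric G.

(** (G5) through the point [y], applied to [G x y x]: by symmetry both terms on the right are
    [G x y y]. *)
Lemma Gmetric_swap (x y : X) : G y x x <= 2 * G x y y.
Proof.
have [_ syx _ _ _] := Gmetric_sym hG y x x.
have [_ _ s _ _] := Gmetric_sym hG x y y.
have [_ _ _ s' _] := Gmetric_sym hG y y x.
by have := Gmetric_triangle hG x y x y; lra.
Qed.

Lemma Gmetric_split (x y z : X) : G x y z <= G x y y + G z y y.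
Proof.
have [_ _ _ s _] := Gmetric_sym hG y y z.
by have := Gmetric_triangle hG x y z y; lra.
Qed.

Lemma Gpreorder_refl (phi : X -> R) (x : X) : Gpreorder G phi x x.
Proof. by rewrite /Gpreorder (Gmetric_xxx hG) subrr. Qed.

Lemma Gpreorder_trans (phi : X -> R) (x y z : X) :
  Gpreorder G phi x y -> Gpreorder G phi y z -> Gpreorder G phi x z.
Proof. by rewrite /Gpreorder; have := Gmetric_triangle hG x z z y; lra. Qed.

Lemma Gpreorder_phi (phi : X -> R) (x y : X) :
  Gpreorder G phi x y -> phi x <= phi y.
Proof. by rewrite /Gpreorder; have := Gmetric_ge0 hG x y y; lra. Qed.

Lemma Gcvg_diag (u : nat -> X) (x : X) :
  Gcvg G u x -> G x (u l) (u l) @[l --> \oo] --> (0 : R).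
Proof.
move=> ux; apply: (cvg_comp (fun l => (l, l)) _ _ ux).
exact: (cvg_pair cvg_id cvg_id).
Qed.

(** Only the diagonal is needed to separate limits, and a one-index limit is easy to shift. *)
Lemma Gcvg_diag_unique (u : nat -> X) (x y : X) :
  G x (u l) (u l) @[l --> \oo] --> (0 : R) ->
  G y (u l) (u l) @[l --> \oo] --> (0 : R) -> x = y.
Proof.
move=> ux uy; apply: contrapT => /(Gmetric_gt0 hG).
have [_ _ _ -> _] := Gmetric_sym hG x x y.
apply/negP; rewrite -leNgt.
have cv : G y (u l) (u l) + 2 * G x (u l) (u l) @[l --> \oo] --> (0 : R).
  rewrite -[X in _ --> X](addr0 (0 : R)) -[X in _ --> _ + X](mulr0 (2 : R)).
  by apply: cvgD => //; apply: cvgMl_tmp.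
(* [G y x x] is at most [G y (u l) (u l) + G (u l) x x], whose last term [Gmetric_swap] bounds. *)
rewrite -(cvg_lim _ cv) //; apply: limr_ge; first by apply/cvg_ex; exists 0.
near=> l.
have := Gmetric_swap x (u l).
by have := Gmetric_triangle hG y x x (u l); lra.
Unshelve. all: by end_near. Qed.

Lemma Gpreorder_homo (phi : X -> R) (u : nat -> X) :
  (forall l, Gpreorder G phi (u l) (u l.+1)) ->
  forall l m, (l <= m)%N -> Gpreorder G phi (u l) (u m).
Proof.
move=> uS l m /subnK <-; elim: (m - l)%N => [|k IH]; first exact: Gpreorder_refl.
by rewrite addSn; apply: Gpreorder_trans IH (uS _).
Qed.

Lemma Gpreorder_nondecreasing_Gcauchy (phi : X -> R) (u : nat -> X) :
  has_ubound (range phi) ->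
  (forall l, Gpreorder G phi (u l) (u l.+1)) -> Gcauchy G u.
Proof.
move=> [M phiM] uS; have uhomo := Gpreorder_homo uS.
(* The factor 2 pays for the case [m < l], where the preorder controls only the reversed
   distance. *)
have dle l m : G (u l) (u m) (u m) <= 2 * `|phi (u m) - phi (u l)|.
  have [lm|/ltnW ml] := leqP l m.
    have := uhomo _ _ lm; rewrite /Gpreorder => h.
    by have := ler_norm (phi (u m) - phi (u l));
       have := normr_ge0 (phi (u m) - phi (u l)); lra.
  have := uhomo _ _ ml; rewrite /Gpreorder distrC => h.
  have := ler_norm (phi (u l) - phi (u m)).
  by have := Gmetric_swap (u m) (u l); lra.
have /cvg_ex[L cvL] : cvgn (phi \o u).
  apply: nondecreasing_is_cvgn; first by move=> l m /uhomo /Gpreorder_phi.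
  by exists M => _ [l _ <-]; apply: phiM; exists (u l).
apply/cvgrPdist_lt => e e0.
(* Two [phi] values differ by less than [e / 4]; [dle] doubles this, and [Gmetric_split] adds two
   such terms. *)
have e8 : 0 < e / 8 by lra.
have [N _ NL] : \forall l \near \oo, `|L - phi (u l)| < e / 8.
  by move/cvgrPdist_lt: cvL; apply.
have Ninf : \forall l \near \oo, (N <= l)%N by exists N.
have Nd l m : (N <= l)%N -> (N <= m)%N -> G (u l) (u m) (u m) < e / 2.
  move=> /NL /= hl /NL /= hm.
  apply: le_lt_trans (dle l m) _.
  have := ler_distD L (phi (u m)) (phi (u l)).
  by rewrite (distrC _ L); lra.
exists ([set l | (N <= l)%N], [set q | (N <= q.1)%N /\ (N <= q.2)%N]).
  by split=> //=; exists ([set l | (N <= l)%N], [set l | (N <= l)%N]).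
move=> p /= [N1 [N2 N3]].
rewrite distrC subr0 ger0_norm ?(Gmetric_ge0 hG) //.
have := Gmetric_split (u p.1) (u p.2.1) (u p.2.2).
by have := Nd _ _ N1 N2; have := Nd _ _ N3 N2; lra.
Qed.

End GMetricTheory.

Section CyclicMap.
Context (X : Type) (n : nat) (F : n.-tuple X -> X).

(** Its fixed points are exactly the $n$-tuple fixed points of [F]. *)
Definition cyclic_map (x : n.-tuple X) : n.-tuple X :=
  [tuple F (rot_tuple i x) | i < n].

Lemma tnth_cyclic_map x i : tnth (cyclic_map x) i = F (rot_tuple i x).
Proof. by rewrite tnth_mktuple. Qed.

Lemma cyclic_map_homo (le : X -> X -> Prop) : preorder_preserving le F ->
  forall x z : n.-tuple X, (forall i, le (tnth x i) (tnth z i)) ->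
  forall i, le (tnth (cyclic_map x) i) (tnth (cyclic_map z) i).
Proof.
move=> Fmono x z xz i; rewrite !tnth_cyclic_map; apply: Fmono => j.
by rewrite (tnth_rot_tuple i x) (tnth_rot_tuple i z); apply: xz.
Qed.

End CyclicMap.

Theorem theorem2p4 (R : realType) (X : Type) (G : X -> X -> X -> R)
    (hG : is_Gmetric G) (hcomplete : Gcomplete G)
    (phi : X -> R) (hphi : has_ubound (range phi))
    (n : nat) (hn : (2 <= n)%N) (F : n.-tuple X -> X)
    (hFmono : preorder_preserving (Gpreorder G phi) F)
    (hFcont : seq_continuous G F)
    (x0 : n.-tuple X)
    (hx0 : forall i : 'I_n, Gpreorder G phi (tnth x0 i) (F (rot_tuple i x0))) :
  exists x : n.-tuple X, tuple_fixpoint F x.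
Proof.
pose u l := iter l (cyclic_map F) x0.
have uS i l : Gpreorder G phi (tnth (u l) i) (tnth (u l.+1) i).
  elim: l i => [|l IH] i; first by rewrite tnth_cyclic_map; apply: hx0.
  exact: cyclic_map_homo.
have /choice[x ux] : forall i, exists y, Gcvg G (fun l => tnth (u l) i) y.
  move=> i; apply: hcomplete.
  exact: (Gpreorder_nondecreasing_Gcauchy hG hphi (uS i)).
exists (mktuple x) => i; rewrite tnth_mktuple.
apply: (@Gcvg_diag_unique _ _ _ hG (fun l => F (rot_tuple i (u l)))).
  by apply/Gcvg_diag/hFcont => j; rewrite tnth_mktuple.
(* [F (rot_tuple i (u l))] is component [i] of [u l.+1], so this sequence is a shift of one tending
   to [x i]. *)
under eq_fun do rewrite -tnth_cyclic_map.
have := Gcvg_diag (ux i).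
by rewrite -(cvg_shiftS (fun l => G (x i) (tnth (u l) i) (tnth (u l) i))).
Qed.
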